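(* Let $m=m(n)$ and $h=h(n)$ be integer sequences, let $N=\binom n2$, and for each $n$ let $\mathscr S=\mathscr S(n)$ be a set of labelled graphs on the vertex set $[n]$, each having exactly $h$ edges. Let $\mu_n=|\mathscr S|\binom{N-h}{m-h}\big/\binom{N}{m}$, which is the expectation $\mathbf E_{\mathcal G(n,m)}X_n$ of the number $X_n$ of members of $\mathscr S$ contained in $\mathcal G(n,m)$. Assume that $h^3=o(m^2)$, $h^2=\Omega(m)$, and that for $\rho(n)=h^2/m$ and some function $\gamma(n)$ the following conditions hold: (a) for all $K>0$ and for all $1\le j\le K\rho(n)$, $$r_j=\frac{h^2}{Nj}\bigl(1+o(m/h^2)\bigr);$$ (b) $r_j\le m/(2N)$ for all $4\rho(n)\le j\le\gamma(n)$; (c) $t(n):=\sum_{j>\gamma(n)}f_j=o(\mu_n|\mathscr S|)$. Then in $\mathcal G(n,m)$, $$\frac{X_n}{\mathbf E_{\mathcal G(n,m)}(X_n)}\xrightarrow{p}1\quad\text{as } n\to\infty.$$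
   Context: $\mathcal G(n,m)$ is the uniformly random graph on vertex set $[n]$ with exactly $m$ edges. All asymptotics are as $n\to\infty$; error terms involving $j$ are uniform over the stated range of $j$ (for each fixed $K$). $X_n=X_n(\mathscr S)$ is the number of members of $\mathscr S$ contained (as spanning subgraphs) in the random graph. For graphs $H_1,H_2$ on $[n]$, $H_1\cap H_2$ denotes the set of edges contained in both. For an integer $j\ge0$, $f_j=f_j(\mathscr S)$ is the number of ordered pairs $(H_1,H_2)\in\mathscr S\times\mathscr S$ with $|H_1\cap H_2|=j$, and for $j\ge1$, $r_j=f_j/f_{j-1}$ whenever $f_{j-1}\ne0$. $\xrightarrow{p}$ denotes convergence in probability. *)

(* Defs.v *)
From mathcomp Require Import all_boot all_order all_algebra.
From mathcomp Require Import all_classical all_reals all_analysis.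

Set Implicit Arguments.
Unset Strict Implicit.
Unset Printing Implicit Defensive.

Import Order.TTheory GRing.Theory Num.Theory.
Import numFieldNormedType.Exports.

Local Open Scope ring_scope.

(* A labelled graph on the vertex set 'I_n is its set of edges, an edge being
   a set of two vertices; every such graph is spanning, so "contained in" is
   inclusion of edge sets. *)
Definition edges (n : nat) : {set {set 'I_n}} := [set e : {set 'I_n} | #|e| == 2].

Definition graphs (n m : nat) : {set {set {set 'I_n}}} :=
  [set G : {set {set 'I_n}} | (G \subset edges n) && (#|G| == m)].

(* Probability and expectation in G(n, m), that is, under the uniform
   distribution on graphs n m; both are 0 when there is no such graph, i.e.
   when 'C(n, 2) < m. *)
Definition Pr_gnm (R : realType) (n m : nat) (A : pred {set {set 'I_n}}) : R :=
  #|[set G in graphs n m | A G]|%:R / #|graphs n m|%:R.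

Definition E_gnm (R : realType) (n m : nat) (Y : {set {set 'I_n}} -> R) : R :=
  (\sum_(G in graphs n m) Y G) / #|graphs n m|%:R.

Definition cvg_in_prob_gnm (R : realType) (m : nat -> nat)
    (Y : forall n, {set {set 'I_n}} -> R) (c : R) : Prop :=
  forall eps : R, 0 < eps ->
    ((fun n => Pr_gnm R (m n) (fun G : {set {set 'I_n}} => eps < `|Y n G - c|))
       @ \oo --> (0 : R))%classic.

Definition num_sub (n : nat) (S : {set {set {set 'I_n}}}) (G : {set {set 'I_n}})
    : nat := #|[set H in S | H \subset G]|.

Definition f_ (n : nat) (S : {set {set {set 'I_n}}}) (j : nat) : nat :=
  #|[set p in finset.setX S S | #|p.1 :&: p.2| == j]|.

(* Meaningful only if 0 < j and f_ S j.-1 != 0; statements about r_ have to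
   assert the latter explicitly. *)
Definition r_ (R : realType) (n : nat) (S : {set {set {set 'I_n}}}) (j : nat) : R :=
  (f_ S j)%:R / (f_ S j.-1)%:R.

(* The subtractions are truncated, so this is the intended value only if
   h <= m and h <= 'C(n, 2). *)
Definition mu_ (R : realType) (n m h : nat) (S : {set {set {set 'I_n}}}) : R :=
  #|S|%:R * 'C('C(n, 2) - h, m - h)%:R / 'C('C(n, 2), m)%:R.

(* The sum over all j > gamma: f_ S j = 0 for j > 'C(n, 2), because the members
   of S are subsets of edges n. *)
Definition tail (R : realType) (n : nat) (S : {set {set {set 'I_n}}}) (gamma : R) : R :=
  \sum_(0 <= j < 'C(n, 2).+1 | gamma < j%:R) (f_ S j)%:R.

(* Main.v *)
Require Import Defs.
From mathcomp Require Import all_boot all_order all_algebra.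
From mathcomp Require Import all_classical all_reals all_analysis.
From mathcomp Require Import ring lra.

Import Order.TTheory GRing.Theory Num.Theory.
Import numFieldNormedType.Exports.

(** The proof is the second moment method.  Write X for the number of members
    of S in G(n, m), N for 'C(n, 2), L k for the probability that a fixed set
    of k edges lies in G(n, m), rho = h^2 / m and nu = h^2 / N <= rho.  Then
    E X = |S| L(h), and grouping the pairs of members of S by the size j of
    their overlap gives E X^2 = \sum_j f_j L(2h - j).  By Chebyshev's
    inequality it suffices that this sum is at most (1 + o(1)) |S|^2 L(h)^2.

    Because h^3 = o(m^2), one has, for j = O(rho),
      L(2h - j) <= L(h)^2 e^(nu - rho) (N / m)^j e^(o(1))
    ([incl_prob_overlap_le]).  By condition (a), f_j = f_0 nu^j / j! e^(o(1))
    in the same range: the overlap of two random members of S looks like a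
    Poisson(nu) variable.  Since \sum_j f_j = |S|^2, this forces
    f_0 e^nu <= (1 + o(1)) |S|^2 ([near_poisson_mass_ge]), provided that the
    range j <= K rho carries nearly all the mass of Poisson(nu); a Chernoff
    bound shows that it does when K is large, as rho is bounded below by
    h^2 = Omega(m).  Multiplying the two estimates, the term of index j is at
    most (1 + o(1)) |S|^2 L(h)^2 times the Poisson(rho) weight of j
    ([head_term_le]), and the part j <= K rho of the sum is at most
    (1 + o(1)) |S|^2 L(h)^2.

    For K rho < j <= gamma, condition (b) makes consecutive terms decay
    geometrically, starting from a term which is already a negligible Poisson
    weight ([geometric_decay_sum_le]).  For j > gamma the trivial bound
    L(2h - j) <= L(h) turns condition (c) into a bound o(1) |S|^2 L(h)^2.

    All this is carried out for one fixed n, with explicit error parameters,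
    in [second_moment_bound]; only the last theorem lets n go to infinity. *)

Local Open Scope ring_scope.

(** * Partial sums of the exponential series *)

Lemma sum_exp_coeff_le_expR (R : realType) (x : R) (J : nat) :
  0 <= x -> \sum_(j < J) x ^+ j / j`!%:R <= expR x.
Proof.
move=> x0; rewrite -(big_mkord predT (fun j => x ^+ j / j`!%:R)).
apply: (@nondecreasing_cvgn_le _ (series (exp_coeff x))).
  by apply/nondecreasing_series => j _ _; exact: exp_coeff_ge0.
exact: is_cvg_series_exp_coeff.
Qed.

(** Turns a uniform bound on the finite blocks from J onwards into a bound on
    the whole remainder, so that no infinite tail sum is ever manipulated. *)
Lemma expR_le_sum_exp_coeff (R : realType) (x c : R) (J : nat) :
  (forall M, \sum_(J <= j < M) x ^+ j / j`!%:R <= c) ->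
  expR x - c <= \sum_(j < J) x ^+ j / j`!%:R.
Proof.
move=> tail_le; rewrite lerBlDr.
apply: limr_le; first exact: is_cvg_series_exp_coeff.
near=> M; rewrite /series /= (@big_cat_nat _ _ _ J)//=; last by near: M; exact: nbhs_infty_ge.
by rewrite big_mkord lerD2l tail_le.
Unshelve. all: by end_near. Qed.

(** Exponential tilting by the factor e, the algebra behind the Chernoff
    bounds for the Poisson distribution below. *)
Lemma exp_coeff_chernoff (R : realType) (x : R) (j : nat) :
  x ^+ j / j`!%:R = (expR 1 * x) ^+ j / j`!%:R * expR (- j%:R).
Proof.
rewrite exprMn -expRM_natr mul1r mulrAC [_ * x ^+ j]mulrC -[x ^+ j * _ * _]mulrA.
by rewrite expRxMexpNx_1 mulr1.
Qed.

(** Times e^(-x), this is the Chernoff bound on a single Poisson weight. *)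
Lemma exp_coeff_le (R : realType) (x : R) (j : nat) :
  0 <= x -> x ^+ j / j`!%:R <= expR (expR 1 * x - j%:R).
Proof.
move=> x0; rewrite exp_coeff_chernoff expRD ler_wpM2r ?expR_ge0//.
have Ex0 : 0 <= expR 1 * x by rewrite mulr_ge0 ?expR_ge0.
apply: le_trans (sum_exp_coeff_le_expR R _ j.+1 Ex0).
rewrite big_ord_recr /= lerDr sumr_ge0// => i _.
by rewrite divr_ge0 ?exprn_ge0.
Qed.

(** Times e^(-x), this is the Chernoff bound on the upper tail of the Poisson
    distribution: in the tilted series every term of index at least J has been
    multiplied by at most e^(-J). *)
Lemma sum_exp_coeff_ge (R : realType) (x : R) (J : nat) :
  0 <= x ->
  expR x - expR (expR 1 * x - J%:R) <= \sum_(j < J) x ^+ j / j`!%:R.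
Proof.
move=> x0; apply: expR_le_sum_exp_coeff => M.
have Ex0 : 0 <= expR 1 * x by rewrite mulr_ge0 ?expR_ge0.
rewrite expRD; apply: le_trans
  (_ : (\sum_(j < M) (expR 1 * x) ^+ j / j`!%:R) * expR (- J%:R) <= _).
  rewrite -(big_mkord predT (fun j => (expR 1 * x) ^+ j / j`!%:R)) mulr_suml.
  have [JM|MJ] := leqP J M; last first.
    rewrite big_geq ?(ltnW MJ)// sumr_ge0// => j _.
    by rewrite !mulr_ge0 ?exprn_ge0 ?invr_ge0 ?expR_ge0.
  rewrite [leRHS](@big_cat_nat _ _ _ J)//=.
  rewrite -[leLHS]add0r lerD//.
    by rewrite sumr_ge0// => j _; rewrite !mulr_ge0 ?exprn_ge0 ?invr_ge0 ?expR_ge0.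
  apply: ler_sum_nat => j /andP[Jj _]; rewrite exp_coeff_chernoff.
  by rewrite ler_wpM2l ?divr_ge0 ?exprn_ge0// ler_expR lerN2 ler_nat.
by rewrite ler_wpM2r ?expR_ge0// sum_exp_coeff_le_expR.
Qed.

(** * The probability that a fixed set of edges is present *)

(** Among the m-subsets of an N-set, the proportion of those that contain a
    given k-subset. *)
Definition incl_prob (R : realType) (N m k : nat) : R :=
  'C(N - k, m - k)%:R / 'C(N, m)%:R.

Lemma incl_prob_gt0 (R : realType) (N m k : nat) :
  (m <= N)%N -> 0 < incl_prob R N m k.
Proof.
by move=> mN; rewrite divr_gt0 ?ltr0n ?bin_gt0 ?leq_sub2r.
Qed.

Lemma incl_prob_ge0 (R : realType) (N m k : nat) :
  0 <= incl_prob R N m k.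
Proof. by rewrite divr_ge0. Qed.

Lemma incl_prob0 (R : realType) (N m : nat) :
  (m <= N)%N -> incl_prob R N m 0 = 1.
Proof.
by move=> mN; rewrite /incl_prob !subn0 divff// pnatr_eq0 -lt0n bin_gt0.
Qed.

Lemma incl_probS (R : realType) (N m k : nat) : (k < m)%N -> (m <= N)%N ->
  incl_prob R N m k.+1 = incl_prob R N m k * ((m%:R - k%:R) / (N%:R - k%:R)).
Proof.
move=> km mN; have kN := leq_trans km mN.
have := mul_bin_diag (N - k) (m - k.+1).
rewrite -subnS subnSK// => /(congr1 (fun i : nat => i%:R : R)).
rewrite !natrM => binE.
rewrite /incl_prob -(natrB _ (ltnW km)) -(natrB _ (ltnW kN)) [RHS]mulrACA.
rewrite (mulrC 'C(N - k, _)%:R) -binE.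
have : (N - k)%:R != 0 :> R by rewrite pnatr_eq0 subn_eq0 -ltnNge.
have : 'C(N, m)%:R != 0 :> R by rewrite pnatr_eq0 -lt0n bin_gt0.
by move=> ? ?; field; apply/andP; split.
Qed.

Lemma incl_prob_antitone (R : realType) (N m k j : nat) :
  (k + j <= m)%N -> (m <= N)%N -> incl_prob R N m (k + j) <= incl_prob R N m k.
Proof.
move=> + mN; elim: j => [|j IH] kjm; first by rewrite addn0.
rewrite addnS in kjm *; rewrite incl_probS//.
apply: le_trans (IH (ltnW kjm)); rewrite ler_piMr ?incl_prob_ge0//.
have : (k + j)%:R + 1 <= m%:R :> R by rewrite natr1 ler_nat.
have : m%:R <= N%:R :> R by rewrite ler_nat.
by move=> ? ?; rewrite ler_pdivrMr; lra.
Qed.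

(** Failure of independence between h edges and k further ones.  Each of the k
    factors (m-i)/(N-i) of L(k) is replaced in L(h+k) by the factor
    (m-h-i)/(N-h-i): the numerator loses a proportion of at least h/m, the
    denominator one of at most h/(N-2h). *)
Lemma incl_prob_add_le (R : realType) (N m h k : nat) :
  (0 < m)%N -> (6 * h <= m)%N -> (m <= N)%N -> (k <= h)%N ->
  incl_prob R N m (h + k) <= incl_prob R N m h * incl_prob R N m k *
    expR (h%:R / (N%:R - 2 * h%:R) - h%:R / m%:R) ^+ k.
Proof.
move=> m0 hm mN; elim: k => [|k IH] kh.
  by rewrite addn0 incl_prob0// expr0 !mulr1.
have hkm : (h + k < m)%N.
  apply: leq_trans hm; rewrite (leq_trans (_ : _ <= h + h)%N) ?ltn_add2l//.
  by rewrite addnn -mul2n leq_mul2r orbT.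
have km : (k < m)%N by apply: leq_ltn_trans hkm; exact: leq_addl.
rewrite addnS !incl_probS// natrD exprSr.
have {}m0 : 0 < m%:R :> R by rewrite ltr0n.
have {}hm : 6 * h%:R <= m%:R :> R by rewrite -natrM ler_nat.
have {}mN : m%:R <= N%:R :> R by rewrite ler_nat.
have {}kh' : k%:R + 1 <= h%:R :> R by rewrite natr1 ler_nat.
have k0 : 0 <= k%:R :> R by [].
set E := expR _.
have step : (m%:R - (h%:R + k%:R)) / (N%:R - (h%:R + k%:R)) <=
            (m%:R - k%:R) / (N%:R - k%:R) * E :> R.
  have mstep : (m%:R - (h%:R + k%:R)) <= (m%:R - k%:R) * expR (- (h%:R / m%:R)) :> R.
    have -> : m%:R - (h%:R + k%:R) = (m%:R - k%:R) * (1 - h%:R / (m%:R - k%:R)) :> R.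
      by field; lra.
    rewrite ler_wpM2l//; first lra.
    apply: le_trans (expR_ge1Dx _); rewrite lerD2l lerN2.
    by rewrite ler_wpM2l// lef_pV2 ?posrE; lra.
  have Nstep : (N%:R - k%:R) <=
      (N%:R - (h%:R + k%:R)) * expR (h%:R / (N%:R - 2 * h%:R)) :> R.
    have -> : N%:R - k%:R = (N%:R - (h%:R + k%:R)) *
        (1 + h%:R / (N%:R - (h%:R + k%:R))) :> R by field; lra.
    rewrite ler_wpM2l//; first lra.
    apply: le_trans (expR_ge1Dx _); rewrite lerD2l.
    by rewrite ler_wpM2l// lef_pV2 ?posrE; lra.
  rewrite /E expRD ler_pdivrMr; last lra.
  apply: le_trans mstep _; set e1 := expR (h%:R / _) in Nstep *.
  rewrite [leRHS](_ : _ = (m%:R - k%:R) * expR (- (h%:R / m%:R)) *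
    ((N%:R - (h%:R + k%:R)) * e1 / (N%:R - k%:R))); last by ring.
  rewrite ler_peMr ?mulr_ge0 ?expR_ge0//; first lra.
  by rewrite ler_pdivlMr ?mul1r//; lra.
have Lh : 0 < incl_prob R N m (h + k) by rewrite incl_prob_gt0// -(ler_nat R).
apply: le_trans (ler_wpM2l (ltW Lh) step) _.
apply: le_trans (ler_wpM2r _ (IH (ltnW kh))) _.
  by rewrite mulr_ge0 ?divr_ge0 ?expR_ge0//; lra.
by rewrite le_eqVlt; apply/orP; left; apply/eqP; ring.
Qed.

(** The case of two disjoint members of S.  Replacing h/(N-2h) by h/N costs
    O(h^2/N^2) per factor, hence O(h^3/m^2) in all. *)
Lemma incl_prob_double_le (R : realType) (N m h : nat) :
  (0 < m)%N -> (6 * h <= m)%N -> (m <= N)%N ->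
  incl_prob R N m (2 * h) <= incl_prob R N m h ^+ 2 *
    expR (h%:R ^+ 2 / N%:R - h%:R ^+ 2 / m%:R + 3 * (h%:R ^+ 3 / m%:R ^+ 2)).
Proof.
move=> m0 hm mN; rewrite mul2n -addnn.
apply: le_trans (incl_prob_add_le R _ _ _ h m0 hm mN (leqnn h)) _.
rewrite expr2 ler_wpM2l//; first by rewrite mulr_ge0 ?incl_prob_ge0.
rewrite -expRM_natl ler_expR.
have {}m0 : 0 < m%:R :> R by rewrite ltr0n.
have {}hm : 6 * h%:R <= m%:R :> R by rewrite -natrM ler_nat.
have {}mN : m%:R <= N%:R :> R by rewrite ler_nat.
have h0 : 0 <= h%:R :> R by [].
move: h%:R m%:R N%:R h0 m0 hm mN => {}h {}m {}N h0 m0 hm mN.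
have -> : h * (h / (N - 2 * h) - h / m) =
   h ^+ 2 / N - h ^+ 2 / m + 3 * (h ^+ 3 / N ^+ 2) * (2 * N / (3 * (N - 2 * h))).
  by field; lra.
rewrite lerD2l.
apply: le_trans (_ : 3 * (h ^+ 3 / N ^+ 2) * 1 <= _).
  rewrite ler_wpM2l ?mulr_ge0 ?invr_ge0 ?exprn_ge0//; first lra.
  by rewrite ler_pdivrMr; lra.
rewrite mulr1 ler_wpM2l// ler_wpM2l ?exprn_ge0// lef_pV2 ?posrE ?exprn_gt0//; last lra.
by apply: lerXn2r; rewrite ?nnegrE; lra.
Qed.

(** Every edge that is dropped costs a factor (N-k)/(m-k) with k < 2h. *)
Lemma incl_prob_drop_le (R : realType) (N m h i j : nat) :
  (0 < m)%N -> (6 * h <= m)%N -> (m <= N)%N -> (j <= i)%N -> (i <= 2 * h)%N ->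
  incl_prob R N m (i - j) <=
    incl_prob R N m i * (N%:R / (m%:R - 2 * h%:R)) ^+ j.
Proof.
move=> m0 hm mN ji ih; elim: j ji => [|j IH] ji.
  by rewrite subn0 expr0 mulr1.
have ijm : (i - j.+1 < m)%N.
  have [h0|h0] := posnP h; first by move: ih ji; rewrite h0; case: (i).
  rewrite (leq_ltn_trans (leq_subr _ _))// (leq_ltn_trans ih)//.
  by apply: leq_trans hm; rewrite ltn_mul2r h0.
have := IH (ltnW ji); rewrite -[(i - j)%N]subnSK// incl_probS// exprSr => {}IH.
set k := (i - j.+1)%N in ijm IH *.
have {}ih : k%:R <= 2 * h%:R :> R.
  by rewrite -natrM ler_nat (leq_trans (leq_subr _ _)).
have {}m0 : 0 < m%:R :> R by rewrite ltr0n.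
have {}hm : 6 * h%:R <= m%:R :> R by rewrite -natrM ler_nat.
have mN' : m%:R <= N%:R :> R by rewrite ler_nat.
have k0 : 0 <= k%:R :> R by [].
have Lk := incl_prob_gt0 R N m k mN.
rewrite [leRHS]mulrA -ler_pdivrMr; last by rewrite divr_gt0//; lra.
apply: le_trans IH; rewrite ler_wpM2l ?incl_prob_ge0// invfM invrK mulrC.
rewrite ler_pM ?invr_ge0//; try lra.
by rewrite lef_pV2 ?posrE; lra.
Qed.

(** The price of the overlap, in the form in which it combines with a Poisson
    weight: multiplying nu^j by (N/m)^j gives rho^j. *)
Lemma incl_prob_overlap_le (R : realType) (N m h j : nat) :
  (0 < m)%N -> (6 * h <= m)%N -> (m <= N)%N -> (j <= 2 * h)%N ->
  incl_prob R N m (2 * h - j) <= incl_prob R N m h ^+ 2 *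
    (expR (h%:R ^+ 2 / N%:R - h%:R ^+ 2 / m%:R + 3 * (h%:R ^+ 3 / m%:R ^+ 2)) *
     ((N%:R / m%:R) ^+ j * expR (3 * (j%:R * h%:R / m%:R)))).
Proof.
move=> m0 hm mN jh.
apply: le_trans (incl_prob_drop_le R _ _ _ _ _ m0 hm mN jh (leqnn _)) _.
rewrite mulrA; apply: ler_pM => //.
- exact: incl_prob_ge0.
- rewrite exprn_ge0 ?divr_ge0// subr_ge0 -natrM ler_nat (leq_trans _ hm)//.
  by rewrite leq_mul2r orbT.
- exact: incl_prob_double_le.
have {}m0 : 0 < m%:R :> R by rewrite ltr0n.
have {}hm : 6 * h%:R <= m%:R :> R by rewrite -natrM ler_nat.
have -> : 3 * (j%:R * h%:R / m%:R) = j%:R * (3 * h%:R / m%:R) :> R by field; lra.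
rewrite expRM_natl -exprMn; apply: lerXn2r.
- by rewrite nnegrE divr_ge0//; lra.
- by rewrite nnegrE mulr_ge0 ?divr_ge0 ?expR_ge0.
rewrite -[leRHS]mulrA ler_wpM2l// -ler_pdivrMl; last by rewrite invr_gt0.
apply: le_trans (expR_ge1Dx _).
rewrite invrK ler_pdivrMr; last lra.
have -> : (1 + 3 * h%:R / m%:R) * (m%:R - 2 * h%:R) =
  m%:R + h%:R * (m%:R - 6 * h%:R) / m%:R :> R by field; lra.
by rewrite lerDl divr_ge0 ?mulr_ge0//; lra.
Qed.

(** * Moments of the number of copies, and Chebyshev's inequality *)

Lemma card_edges (n : nat) : #|edges n| = 'C(n, 2).
Proof. by rewrite /edges card_draws card_ord. Qed.

Lemma card_graphs (n m : nat) : #|graphs n m| = 'C('C(n, 2), m).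
Proof. by rewrite /graphs cards_draws card_edges. Qed.

(** Adding U is a bijection from the (m - #|U|)-subsets of E :\: U. *)
Lemma card_supersets (T : finType) (E U : {set T}) (m : nat) :
  U \subset E -> (#|U| <= m)%N ->
  #|[set G : {set T} | [&& U \subset G, G \subset E & #|G| == m]]|
    = 'C(#|E| - #|U|, m - #|U|).
Proof.
move=> UE Um; have <- : #|E :\: U| = (#|E| - #|U|)%N.
  by rewrite cardsD (finset.setIidPr UE).
rewrite -cards_draws -[RHS](card_in_imset (f := fun A => A :|: U)); last first.
  move=> A B; rewrite !inE.
  rewrite !finset.subsetD => /andP[/andP[_ AU] _] /andP[/andP[_ BU] _].
  move=> /(congr1 (fun X => X :\: U)).
  rewrite !finset.setDUl finset.setDv !finset.setU0.
  by rewrite (finset.setDidPl AU) (finset.setDidPl BU).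
apply: eq_card => G; rewrite !inE.
apply/and3P/imsetP => [[UG GE /eqP Gm]|[A]].
  exists (G :\: U); last by rewrite finset.setUC -{1}(finset.setIidPr UG) finset.setID.
  by rewrite inE finset.setSD//= cardsD (finset.setIidPr UG) Gm.
rewrite inE finset.subsetD => /andP[/andP[AE AU] /eqP Am] ->.
rewrite finset.subsetUr finset.subUset AE UE; split=> //.
by rewrite cardsU (finset.disjoint_setI0 AU) cards0 subn0 Am subnK.
Qed.

Lemma sum_indicator (R : pzSemiRingType) (T : finType) (A : {set T}) (P : pred T) :
  \sum_(x in A) (P x)%:R = #|[set x in A | P x]|%:R :> R.
Proof.
rewrite -sum1_card natr_sum [RHS](eq_bigl (fun x => (x \in A) && P x)).
  by rewrite big_mkcondr; apply: eq_bigr => x _; case: (P x).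
by move=> x; rewrite inE.
Qed.

Lemma E_gnm_superset (R : realType) (n m : nat) (U : {set {set 'I_n}}) :
  U \subset edges n -> (#|U| <= m)%N ->
  E_gnm m (fun G => (U \subset G)%:R) = incl_prob R 'C(n, 2) m #|U|.
Proof.
move=> UE Um; rewrite /E_gnm /incl_prob card_graphs -card_edges.
rewrite -(card_supersets _ _ _ _ UE Um); congr (_ / _).
rewrite sum_indicator; congr (_%:R).
by apply: eq_card => G; rewrite !inE andbC.
Qed.

Lemma E_gnm_sum (R : realType) (n m : nat) (I : Type) (r : seq I) (P : pred I)
    (Y : I -> {set {set 'I_n}} -> R) :
  E_gnm m (fun G => \sum_(i <- r | P i) Y i G) = \sum_(i <- r | P i) E_gnm m (Y i).
Proof. by rewrite /E_gnm exchange_big mulr_suml. Qed.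

Lemma E_gnm_num_sub (R : realType) (n m h : nat) (S : {set {set {set 'I_n}}}) :
  S \subset graphs n h -> (h <= m)%N ->
  E_gnm m (fun G => (num_sub S G)%:R) = #|S|%:R * incl_prob R 'C(n, 2) m h.
Proof.
move=> Sh hm; rewrite [LHS](_ : _ =
    E_gnm m (fun G => \sum_(H in S) (H \subset G)%:R)); last first.
  by congr (_ / _); apply: eq_bigr => G _; rewrite sum_indicator.
rewrite E_gnm_sum (eq_bigr (fun=> incl_prob R 'C(n, 2) m h)).
  by rewrite sumr_const mulr_natl.
move=> H /(fintype.subsetP Sh); rewrite inE => /andP[HE /eqP Hh].
by rewrite E_gnm_superset ?Hh.
Qed.

(** Members of S have h edges, so overlaps have size at most h and the sum
    over j can stop there. *)
Lemma sum_overlap (R : realType) (n h : nat) (S : {set {set {set 'I_n}}})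
    (F : nat -> R) :
  S \subset graphs n h ->
  \sum_(p in finset.setX S S) F #|p.1 :&: p.2| = \sum_(j < h.+1) (f_ S j)%:R * F j.
Proof.
move=> Sh; rewrite (eq_bigr (fun j : 'I_h.+1 =>
    \sum_(p in finset.setX S S | #|p.1 :&: p.2| == j) F j)); last first.
  move=> j _; rewrite sumr_const mulr_natl; congr (_ *+ _).
  by apply: eq_card => p; rewrite !inE [RHS]unfold_in /= !inE.
under [RHS]eq_bigr do rewrite big_mkcondr.
rewrite exchange_big /=; apply: eq_bigr => -[H1 H2] /=.
rewrite finset.in_setX => /andP[/(fintype.subsetP Sh) + _].
rewrite inE => /andP[_ /eqP H1h].
have lt : (#|H1 :&: H2| < h.+1)%N.
  by rewrite ltnS -H1h subset_leq_card// finset.subsetIl.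
by rewrite -big_mkcond (big_pred1 (Ordinal lt))// => j.
Qed.

Lemma sum_f_ (R : realType) (n h : nat) (S : {set {set {set 'I_n}}}) :
  S \subset graphs n h -> \sum_(j < h.+1) (f_ S j)%:R = #|S|%:R ^+ 2 :> R.
Proof.
move=> Sh; under eq_bigr do rewrite -[_%:R]mulr1.
rewrite -(sum_overlap R n h S (fun=> 1) Sh) sumr_const cardsX natrM.
by rewrite expr2.
Qed.

(** X^2 counts the pairs of members of S whose union lies in the random graph,
    and that union has 2h - j edges when the overlap has j. *)
Lemma E_gnm_num_sub_sqr (R : realType) (n m h : nat) (S : {set {set {set 'I_n}}}) :
  S \subset graphs n h -> (2 * h <= m)%N ->
  E_gnm m (fun G => (num_sub S G)%:R ^+ 2) =
  \sum_(j < h.+1) (f_ S j)%:R * incl_prob R 'C(n, 2) m (2 * h - j).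
Proof.
move=> Sh hm; rewrite -(sum_overlap _ _ _ _ (fun j => incl_prob R _ m (2 * h - j)) Sh).
rewrite [LHS](_ : _ =
    E_gnm m (fun G => \sum_(p in finset.setX S S) (p.1 :|: p.2 \subset G)%:R)).
  rewrite E_gnm_sum; apply: eq_bigr => -[H1 H2] /=.
  rewrite finset.in_setX => /andP[/(fintype.subsetP Sh) + /(fintype.subsetP Sh)].
  rewrite !inE => /andP[H1E /eqP H1h] /andP[H2E /eqP H2h].
  have H12 : #|H1 :|: H2| = (2 * h - #|H1 :&: H2|)%N.
    by rewrite cardsU H1h H2h addnn mul2n.
  by rewrite E_gnm_superset ?H12// ?finset.subUset ?H1E// (leq_trans (leq_subr _ _)).
congr (_ / _); apply: eq_bigr => G _.
rewrite sum_indicator -natrX -mulnn -cardsX; congr (_%:R).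
by apply: eq_card => -[H1 H2]; rewrite !inE /= finset.subUset andbACA.
Qed.

Lemma Pr_gnm_markov (R : realType) (n m : nat) (A : pred {set {set 'I_n}})
    (W : {set {set 'I_n}} -> R) :
  (forall G, 0 <= W G) -> (forall G, A G -> 1 <= W G) ->
  Pr_gnm R m A <= E_gnm m W.
Proof.
move=> W0 WA; rewrite ler_wpM2r ?invr_ge0//.
rewrite -sum_indicator.
by apply: ler_sum => G _; case: (boolP (A G)) => [/WA|].
Qed.

Lemma Pr_gnm_chebyshev (R : realType) (n m : nat) (Y : {set {set 'I_n}} -> R)
    (eps : R) :
  (m <= 'C(n, 2))%N -> 0 < eps -> E_gnm m Y != 0 ->
  Pr_gnm R m (fun G => eps < `|Y G / E_gnm m Y - 1|) <=
  (E_gnm m (fun G => Y G ^+ 2) / E_gnm m Y ^+ 2 - 1) / eps ^+ 2.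
Proof.
move=> mN eps0; set mu := E_gnm m Y => mu0.
apply: le_trans (Pr_gnm_markov _ _ _ _
  (fun G => (Y G / mu - 1) ^+ 2 / eps ^+ 2) _ _) _ => [G|G ltG|].
- by rewrite divr_ge0 ?sqr_ge0.
- rewrite ler_pdivlMr ?exprn_gt0// mul1r -[leRHS]real_normK ?num_real//.
  by rewrite lerXn2r ?nnegrE// ltW.
have g0 : #|graphs n m|%:R != 0 :> R.
  by rewrite pnatr_eq0 card_graphs -lt0n bin_gt0.
have sumY : \sum_(G in graphs n m) Y G = mu * #|graphs n m|%:R.
  by rewrite /mu /E_gnm divfK.
rewrite /E_gnm -mulr_suml le_eqVlt; apply/orP; left; apply/eqP.
rewrite (eq_bigr (fun G => Y G ^+ 2 / mu ^+ 2 - 2 / mu * Y G + 1)); last first.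
  by move=> G _; field.
rewrite !big_split /= sumrN -mulr_suml -mulr_sumr sumY sumr_const -[1 *+ _]/(_%:R).
by field; rewrite mu0 g0 gt_eqF.
Qed.

(** * Nearly Poisson sequences and geometric decay *)

(** Condition (a) on the range j <= J, with the quotients cleared: for delta = 0
    it says that f is proportional to nu^j / j! there. *)
Definition near_poisson_ratios (R : realType) (f : nat -> R) (nu delta : R) (J : nat) :=
  forall j : nat, (j < J)%N -> exists2 e : R, `|e| <= delta &
    f j.+1 = f j * (nu / j.+1%:R * (1 + e)).

Lemma exp_coeffS (R : realType) (x : R) (j : nat) :
  x ^+ j.+1 / j.+1`!%:R = x ^+ j / j`!%:R * (x / j.+1%:R).
Proof. by rewrite exprSr factS mulnC natrM invfM mulrACA. Qed.

Lemma near_poisson_le (R : realType) (f : nat -> R) (nu delta : R) (J j : nat) :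
  (forall i, 0 <= f i) -> 0 <= nu -> near_poisson_ratios R f nu delta J ->
  (j <= J)%N -> f j <= f 0%N * (nu ^+ j / j`!%:R) * expR (delta * j%:R).
Proof.
move=> f0 nu0 fJ; elim: j => [|j IH] jJ.
  by rewrite expr0 fact0 divr1 mulr0 expR0 !mulr1.
have [e edelta ->] := fJ j jJ.
rewrite [leRHS](_ : _ = f 0%N * (nu ^+ j / j`!%:R) * expR (delta * j%:R) *
   (nu / j.+1%:R * expR delta)); last first.
  by rewrite -[in expR _]natr1 mulrDr mulr1 expRD exp_coeffS; ring.
apply: le_trans (ler_wpM2r _ (IH (ltnW jJ))); last first.
  by rewrite mulr_ge0 ?expR_ge0 ?divr_ge0.
rewrite ler_wpM2l// ler_wpM2l ?divr_ge0//.
by rewrite (le_trans (expR_ge1Dx _))// ler_expR (le_trans (ler_norm _)).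
Qed.

(** Bernoulli's inequality for the product of the j factors 1 - delta; as soon
    as J > 0, the bound on delta * J makes them nonnegative. *)
Lemma near_poisson_ge (R : realType) (f : nat -> R) (nu delta : R) (J j : nat) :
  (forall i, 0 <= f i) -> 0 <= nu -> near_poisson_ratios R f nu delta J ->
  0 <= delta -> delta * J%:R <= 1 ->
  (j <= J)%N -> f 0%N * (nu ^+ j / j`!%:R) * (1 - delta * j%:R) <= f j.
Proof.
move=> f0 nu0 fJ d0 dJ; elim: j => [|j IH] jJ.
  by rewrite expr0 fact0 divr1 mulr0 subr0 !mulr1.
have [e edelta ->] := fJ j jJ.
have /andP[ne le] : (- delta <= e <= delta) by rewrite -ler_norml.
have d1 : delta <= 1.
  by apply: le_trans dJ; rewrite ler_peMr// ler1n (leq_trans _ jJ).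
apply: le_trans (_ : f j * (nu / j.+1%:R * (1 - delta)) <= _); last first.
  by rewrite ler_wpM2l// ler_wpM2l ?divr_ge0//; lra.
apply: le_trans (ler_wpM2r _ (IH (ltnW jJ))); last first.
  by rewrite mulr_ge0 ?divr_ge0//; lra.
rewrite [leRHS](_ : _ = f 0%N * (nu ^+ j.+1 / j.+1`!%:R) *
   ((1 - delta * j%:R) * (1 - delta))); last first.
  by rewrite exp_coeffS; ring.
rewrite ler_wpM2l ?mulr_ge0 ?invr_ge0 ?exprn_ge0//.
have : 0 <= delta * (delta * j%:R) by rewrite !mulr_ge0.
by rewrite -[j.+1%:R]natr1; lra.
Qed.

(** The total mass controls f 0: up to the errors w and tau, the terms of index
    at most J already sum to f 0 * expR nu.  Here tau bounds the relative
    weight of the part of the Poisson distribution that lies beyond J. *)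
Lemma near_poisson_mass_ge (R : realType) (f : nat -> R) (nu delta w tau : R) (J M : nat) :
  (forall i, 0 <= f i) -> 0 <= nu -> near_poisson_ratios R f nu delta J ->
  0 <= delta -> delta * J%:R <= w -> w <= 1 ->
  expR ((expR 1 - 1) * nu - J.+1%:R) <= tau -> (J <= M)%N ->
  f 0%N * expR nu * ((1 - w) * (1 - tau)) <= \sum_(j < M.+1) f j.
Proof.
move=> f0 nu0 fJ d0 dJ w1 tauE JM.
apply: le_trans (_ : \sum_(j < J.+1) f j <= _); last first.
  rewrite -!(big_mkord predT f) [leRHS](@big_cat_nat _ _ _ J.+1)//=.
  by rewrite lerDl sumr_ge0.
apply: le_trans (_ : \sum_(j < J.+1) f 0%N * (1 - w) * (nu ^+ j / j`!%:R) <= _).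
  rewrite -mulr_sumr [leLHS](_ : _ = f 0%N * (1 - w) * (expR nu * (1 - tau))); last by ring.
  rewrite ler_wpM2l ?mulr_ge0 ?subr_ge0//.
  apply: le_trans (sum_exp_coeff_ge _ _ _ nu0).
  rewrite mulrBr mulr1 lerD2l lerN2.
  rewrite [leLHS](_ : _ = expR nu * expR ((expR 1 - 1) * nu - J.+1%:R)).
    by rewrite ler_wpM2l ?expR_ge0.
  by rewrite -expRD; congr expR; ring.
apply: ler_sum => -[j /= jJ] _.
apply: le_trans (near_poisson_ge _ _ _ _ _ _ f0 nu0 fJ d0 (le_trans dJ w1) jJ).
rewrite mulrAC ler_wpM2l ?mulr_ge0 ?invr_ge0 ?exprn_ge0//.
by rewrite lerD2l lerN2 (le_trans _ dJ)// ler_wpM2l// ler_nat.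
Qed.

(** P selects an initial segment of the indices beyond J, in the application
    those not exceeding gamma and h; the decay is needed only there. *)
Lemma geometric_decay_sum_le (R : realType) (a : nat -> R) (b q : R)
    (P : pred nat) (J M : nat) :
  0 <= b -> 0 <= q < 1 -> a J <= b ->
  (forall j, P j.+1 -> (J < j)%N -> P j) ->
  (forall j, (J <= j)%N -> P j.+1 -> a j.+1 <= q * a j) ->
  \sum_(J.+1 <= j < M | P j) a j <= b / (1 - q).
Proof.
move=> b0 /andP[q0 q1] aJ Pdown adec.
have decay k : (k == 0%N) || P (J + k)%N -> a (J + k)%N <= b * q ^+ k.
  elim: k => [|k IH]; first by rewrite addn0 expr0 mulr1.
  rewrite addnS => /= PJk; apply: le_trans (adec _ (leq_addr _ _) PJk) _.
  rewrite exprS mulrCA ler_wpM2l// IH//.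
  by case: k PJk {IH} => // k PJk; rewrite Pdown// addnS ltnS leq_addr.
apply: le_trans (_ : \sum_(J.+1 <= j < M) b * q ^+ (j - J) <= _).
  rewrite big_mkcond; apply: ler_sum_nat => j /andP[Jj _].
  case: ifPn => [Pj|_]; last by rewrite mulr_ge0 ?exprn_ge0.
  by have := decay (j - J)%N; rewrite subnKC ?(ltnW Jj)// Pj orbT; apply.
rewrite -mulr_sumr ler_wpM2l//.
rewrite -[J.+1]add0n big_addn big_mkord.
apply: le_trans (_ : \sum_(i < M - J.+1) q ^+ i <= _).
  apply: ler_sum => i _; rewrite addnS -addSn addnK exprS.
  by rewrite ler_piMl ?exprn_ge0// ltW.
rewrite -div1r ler_pdivlMr; last by rewrite subr_gt0.
have := subrX1 q (M - J.+1); have : 0 <= q ^+ (M - J.+1) by rewrite exprn_ge0.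
lra.
Qed.

(** * The second moment for one fixed n *)

Lemma expR_le_invB (R : realType) (x : R) : x < 1 -> expR x <= (1 - x)^-1.
Proof.
move=> x1; rewrite -[expR x]invrK -expRN lef_pV2 ?posrE ?expR_gt0 ?subr_gt0//.
exact: expR_ge1Dx.
Qed.

(** The product of [near_poisson_le] and [incl_prob_overlap_le].  The errors
    are at most delta K rho, 3 h^3/m^2 and 3 j h/m <= 3 K h^3/m^2, all
    accounted for by w. *)
Lemma head_term_le (R : realType) (N m h : nat) (f : nat -> R) (K delta w : R) (j : nat)
    (rho := h%:R ^+ 2 / m%:R : R) (nu := h%:R ^+ 2 / N%:R : R) :
  (0 < m)%N -> (6 * h <= m)%N -> (m <= N)%N -> (forall i, 0 <= f i) ->
  (j <= h)%N -> j%:R <= K * rho -> 0 <= delta ->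
  delta * (K * rho) + 3 * (1 + K) * (h%:R ^+ 3 / m%:R ^+ 2) <= w ->
  near_poisson_ratios R f nu delta j ->
  f j * incl_prob R N m (2 * h - j) <=
  f 0%N * expR nu * incl_prob R N m h ^+ 2 * expR w *
    (expR (- rho) * (rho ^+ j / j`!%:R)).
Proof.
move=> m0 hm mN f0 jh jK d0 wE fj.
have nu0 : 0 <= nu by rewrite divr_ge0 ?sqr_ge0.
have j2h : (j <= 2 * h)%N by rewrite (leq_trans jh)// leq_pmull.
apply: le_trans (ler_pM (f0 j) (incl_prob_ge0 R N m _)
  (near_poisson_le R f nu delta j j f0 nu0 fj (leqnn j))
  (incl_prob_overlap_le R N m h j m0 hm mN j2h)) _.
have m0' : 0 < m%:R :> R by rewrite ltr0n.
have N0' : 0 < N%:R :> R by rewrite ltr0n (leq_trans m0).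
rewrite -/rho -/nu.
have -> : rho ^+ j = nu ^+ j * (N%:R / m%:R) ^+ j.
  by rewrite -exprMn; congr (_ ^+ _); rewrite /nu /rho; field; lra.
set y := h%:R ^+ 3 / m%:R ^+ 2 in wE *.
set z := j%:R * h%:R / m%:R.
have zle : z <= K * y.
  rewrite /z /y -mulrA (_ : h%:R ^+ 3 / _ = rho * (h%:R / m%:R)); last first.
    by rewrite /rho; field; lra.
  by rewrite [leRHS]mulrA ler_wpM2r ?divr_ge0.
have dle : delta * j%:R <= delta * (K * rho) by rewrite ler_wpM2l.
have ewE : expR (delta * j%:R) * expR (3 * y) * expR (3 * z) <= expR w.
  by rewrite -!expRD ler_expR; lra.
rewrite !expRD [leLHS](_ : _ = f 0%N * expR nu * incl_prob R N m h ^+ 2 *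
   (expR (delta * j%:R) * expR (3 * y) * expR (3 * z)) *
   (expR (- rho) * (nu ^+ j * (N%:R / m%:R) ^+ j / j`!%:R))); last by ring.
rewrite ler_wpM2r//.
  by rewrite !mulr_ge0 ?expR_ge0 ?invr_ge0 ?exprn_ge0 ?divr_ge0.
by rewrite ler_wpM2l// !mulr_ge0 ?expR_ge0 ?exprn_ge0 ?incl_prob_ge0.
Qed.

(** Every overlap satisfies j <= J = floor(K rho), J < j <= gamma or j > gamma;
    these three ranges contribute the terms 1, 4 tau and kappa.  The parameter
    tau bounds both the Poisson tail lost in estimating f 0 and the
    Poisson(rho) weight of J, from which the geometric decay starts; the
    summand 1 in its exponent is for the rounding of K rho down to J. *)
Lemma second_moment_bound (R : realType) (N m h : nat) (f : nat -> R)
    (gamma K delta w tau kappa : R)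
    (rho := h%:R ^+ 2 / m%:R : R) (nu := h%:R ^+ 2 / N%:R : R)
    (T := \sum_(j < h.+1) f j) :
  (0 < m)%N -> (6 * h <= m)%N -> (m <= N)%N -> (forall i, 0 <= f i) ->
  4 <= K -> K * h%:R <= m%:R -> 0 <= delta ->
  delta * (K * rho) + 3 * (1 + K) * (h%:R ^+ 3 / m%:R ^+ 2) <= w -> w < 1 ->
  expR (1 + (expR 1 - K) * rho) <= tau -> tau < 1 ->
  (forall j, j.+1%:R <= K * rho -> exists2 e : R, `|e| <= delta &
     f j.+1 = f j * (nu / j.+1%:R * (1 + e))) ->
  (forall j, 4 * rho <= j.+1%:R -> j.+1%:R <= gamma ->
     f j.+1 <= f j * (m%:R / (2 * N%:R))) ->
  \sum_(j < h.+1 | gamma < j%:R) f j <= kappa * T * incl_prob R N m h ->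
  \sum_(j < h.+1) f j * incl_prob R N m (2 * h - j) <=
    T * incl_prob R N m h ^+ 2 * ((1 + 4 * tau) / ((1 - w) ^+ 2 * (1 - tau)) + kappa).
Proof.
move=> m0 hm mN f0 K4 Khm d0 wE w1 tauE tau1 fa fb fc.
set L := incl_prob R N m in fc *.
have m0' : 0 < m%:R :> R by rewrite ltr0n.
have mN' : m%:R <= N%:R :> R by rewrite ler_nat.
have hm' : 6 * h%:R <= m%:R :> R by rewrite -natrM ler_nat.
have E1 : 1 <= expR 1 :> R by rewrite -[X in X <= _]expR0 ler_expR.
have rho0 : 0 <= rho by rewrite divr_ge0 ?sqr_ge0.
have nu0 : 0 <= nu by rewrite divr_ge0 ?sqr_ge0.
have nurho : nu <= rho.
  by rewrite ler_wpM2l ?sqr_ge0// lef_pV2 ?posrE//; lra.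
have tau0 : 0 <= tau by apply: le_trans tauE; exact: expR_ge0.
have y0 : 0 <= h%:R ^+ 3 / m%:R ^+ 2 :> R by rewrite divr_ge0 ?exprn_ge0.
have Krho0 : 0 <= K * rho by rewrite mulr_ge0//; lra.
set J := Num.truncn (K * rho).
have JK : J%:R <= K * rho by rewrite truncn_le.
have KJ : K * rho < J.+1%:R by rewrite -truncn_lt_nat.
have Jh : (J <= h)%N.
  rewrite -(ler_nat R) (le_trans JK)//.
  rewrite /rho [leLHS](_ : _ = h%:R * (K * h%:R / m%:R)); last by field; lra.
  by rewrite ler_piMr// ler_pdivrMr// mul1r.
have fJ : near_poisson_ratios R f nu delta J.
  move=> j jJ; apply: fa; rewrite (le_trans _ JK)// ler_nat//.
have w0 : 0 <= w.
  by apply: le_trans wE; rewrite addr_ge0 ?mulr_ge0//; lra.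
(* B is the common factor of the Poisson(rho) weights in the head terms, and C
   is the bound on B that the total mass T imposes. *)
pose B := f 0%N * expR nu * L h ^+ 2 * expR w.
have B0 : 0 <= B by rewrite !mulr_ge0 ?expR_ge0 ?exprn_ge0 ?incl_prob_ge0.
pose C := T * L h ^+ 2 / ((1 - w) ^+ 2 * (1 - tau)).
have BC : B <= C.
  have mass : f 0%N * expR nu * ((1 - w) * (1 - tau)) <= T.
    apply: (near_poisson_mass_ge _ _ _ _ _ _ _ _ f0 nu0 fJ d0 _ (ltW w1) _ Jh).
      apply: le_trans wE; apply: le_trans (_ : delta * (K * rho) <= _).
        by rewrite ler_wpM2l.
      by rewrite lerDl !mulr_ge0//; lra.
    apply: le_trans tauE; rewrite ler_expR.
    have : (expR 1 - 1) * nu <= (expR 1 - 1) * rho by rewrite ler_wpM2l// subr_ge0.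
    have : K * rho < J.+1%:R by [].
    by lra.
  rewrite /C ler_pdivlMr; last by rewrite mulr_gt0 ?exprn_gt0//; lra.
  have ew : expR w * (1 - w) <= 1.
    by rewrite -ler_pdivlMr ?subr_gt0// div1r expR_le_invB.
  rewrite [leLHS](_ : _ = (f 0%N * expR nu * ((1 - w) * (1 - tau))) * L h ^+ 2 *
    (expR w * (1 - w))); last by rewrite /B; ring.
  apply: le_trans (_ : T * L h ^+ 2 * 1 <= _); last by rewrite mulr1.
  apply: ler_pM => //.
  - by rewrite !mulr_ge0 ?expR_ge0 ?exprn_ge0 ?incl_prob_ge0//; lra.
  - by rewrite mulr_ge0 ?expR_ge0//; lra.
  - by rewrite ler_wpM2r ?exprn_ge0 ?incl_prob_ge0.
pose a j := f j * L (2 * h - j)%N.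
have head j : (j <= J)%N -> a j <= B * (expR (- rho) * (rho ^+ j / j`!%:R)).
  move=> jJ; apply: (head_term_le _ _ _ _ _ K delta) => //.
  - exact: leq_trans Jh.
  - by rewrite (le_trans _ JK)// ler_nat.
  - by move=> i ij; apply: fJ; exact: leq_trans jJ.
have headsum : \sum_(j < J.+1) a j <= B.
  apply: le_trans (_ : \sum_(j < J.+1) B * (expR (- rho) * (rho ^+ j / j`!%:R)) <= _).
    by apply: ler_sum => -[j jJ] _; exact: head.
  rewrite -!mulr_sumr ler_piMr// expRN ler_pdivrMl ?expR_gt0// mulr1.
  exact: sum_exp_coeff_le_expR.
have aJ : a J <= B * tau.
  apply: le_trans (head J (leqnn J)) _; rewrite ler_wpM2l//.
  apply: le_trans tauE.
  apply: le_trans (ler_wpM2l (expR_ge0 _) (exp_coeff_le _ _ J rho0)) _.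
  rewrite -expRD ler_expR.
  have : K * rho < J%:R + 1 by rewrite natr1.
  by lra.
(* The decay factor 3/4 exceeds the factor 1/2 of (b) because of the change of
   L, which is at most m / (m - 2h) <= 3/2 relative to N / m. *)
have mid : \sum_(J.+1 <= j < h.+1 | j%:R <= gamma) a j <= 4 * (B * tau).
  rewrite [leRHS](_ : _ = (B * tau) / (1 - 3 / 4)); last by field.
  rewrite big_nat_cond (eq_bigl (fun j =>
    (J < j < h.+1)%N && ((j <= h)%N && (j%:R <= gamma)))).
    rewrite -big_nat_cond; apply: geometric_decay_sum_le => //.
    - by rewrite mulr_ge0.
    - by lra.
    - move=> j /andP[jh jg] _; rewrite ltnW//= (le_trans _ jg)//.
      by rewrite ler_nat.
    move=> j Jj /andP[jh jg].
    have fj : f j.+1 <= f j * (m%:R / (2 * N%:R)).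
      apply: fb => //; apply: le_trans (_ : K * rho <= _); first by rewrite ler_wpM2r.
      by rewrite (le_trans (ltW KJ))// ler_nat ltnS.
    have j2h : (j < 2 * h)%N by rewrite (leq_trans jh)// leq_pmull.
    have Lj := incl_prob_drop_le R _ _ _ (2 * h - j) 1 m0 hm mN.
    rewrite subn_gt0 leq_subr in Lj; have {}Lj := Lj j2h isT.
    rewrite expr1 -subnDA addn1 in Lj.
    apply: le_trans (ler_pM (f0 _) (incl_prob_ge0 _ _ _ _) fj Lj) _.
    rewrite [leLHS](_ : _ = a j * (m%:R / (2 * (m%:R - 2 * h%:R)))); last first.
      by rewrite /a /L; field; lra.
    rewrite mulrC ler_wpM2r ?mulr_ge0 ?incl_prob_ge0//.
    by rewrite ler_pdivrMr; lra.
  by move=> j; rewrite ltnS; case: (j <= h)%N; rewrite ?andbT ?andbF.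
have tail : \sum_(j < h.+1 | gamma < j%:R) a j <= kappa * T * L h ^+ 2.
  rewrite expr2 mulrA; apply: le_trans (ler_wpM2r (incl_prob_ge0 _ _ _ _) fc).
  rewrite mulr_suml; apply: ler_sum => -[j /= jh] _.
  rewrite ler_wpM2l//.
  rewrite (_ : 2 * h - j = h + (h - j))%N; last by rewrite addnBA// addnn mul2n.
  apply: incl_prob_antitone => //; rewrite addnBA// addnn -mul2n.
  by rewrite (leq_trans (leq_subr _ _))// (leq_trans _ hm)// leq_mul2r orbT.
rewrite -(big_mkord predT a) (@big_cat_nat _ _ _ J.+1)//= big_mkord.
rewrite [X in _ + X <= _](bigID (fun j : nat => gamma < j%:R)) /=.
under [X in _ + (_ + X) <= _]eq_bigl do rewrite -leNgt.
have tail' : \sum_(J.+1 <= j < h.+1 | gamma < j%:R) a j <= kappa * T * L h ^+ 2.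
  apply: le_trans tail.
  rewrite -(big_mkord (fun j => gamma < j%:R) a) [leRHS](@big_cat_nat _ _ _ J.+1)//=.
  by rewrite lerDr sumr_ge0// => j _; rewrite mulr_ge0 ?incl_prob_ge0.
have tauBC : B * tau <= C * tau by rewrite ler_wpM2r.
apply: le_trans (_ : C + (kappa * T * L h ^+ 2 + 4 * (C * tau)) <= _); first by lra.
by rewrite le_eqVlt; apply/orP; left; apply/eqP; rewrite /C; ring.
Qed.

(** * Passage to the limit *)

(** With w = tau = kappa = eps / 20, the bound of
    [second_moment_bound] leaves a relative variance of at most eps. *)
Lemma error_budget (R : realType) (eps : R) (t := eps / 20) :
  0 < eps <= 1 ->
  (1 + 4 * t) / ((1 - t) ^+ 2 * (1 - t)) + t - 1 <= eps.
Proof.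
move=> /andP[e0 e1]; have {e0 e1} [t0 t1] : 0 < t /\ t <= 1 / 20.
  by rewrite /t; lra.
have -> : eps = 20 * t by rewrite /t; field.
suff : (1 + 4 * t) / ((1 - t) ^+ 2 * (1 - t)) <= 1 + 15 * t by lra.
rewrite -exprSr ler_pdivrMr ?exprn_gt0//; last lra.
have t2 : 0 <= t ^+ 2 by exact: sqr_ge0.
have : 0 <= t * (1 / 20 - t) by rewrite mulr_ge0//; lra.
have : 0 <= t ^+ 2 * (1 / 20 - t) by rewrite mulr_ge0//; lra.
have : 0 <= t ^+ 3 * (1 / 20 - t) by rewrite mulr_ge0 ?exprn_ge0//; lra.
have : 0 <= t ^+ 3 by rewrite exprn_ge0// ltW.
have -> : (1 - t) ^+ 3 = 1 - 3 * t + 3 * t ^+ 2 - t ^+ 3 by ring.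
have -> : (1 + 15 * t) * (1 - 3 * t + 3 * t ^+ 2 - t ^+ 3) =
  1 + 12 * t - 42 * t ^+ 2 + 44 * t ^+ 3 - 15 * (t ^+ 3 * t) by ring.
lra.
Qed.

(** How h^3 = o(m^2) yields h = o(m): since m >= 1, also h^3 = o(m^3). *)
Lemma mul_le_of_cube_le (R : realType) (A h m : R) :
  0 <= A -> 0 <= h -> 1 <= m -> h ^+ 3 <= (A ^+ 3 + 1)^-1 * m ^+ 2 -> A * h <= m.
Proof.
move=> A0 h0 m1 hm.
have A3 : 0 <= A ^+ 3 by rewrite exprn_ge0.
rewrite -(@ler_pXn2r _ 3)// ?nnegrE ?mulr_ge0//; last lra.
rewrite exprMn; apply: le_trans (_ : 1 * m ^+ 2 <= _).
  apply: le_trans (ler_wpM2l A3 hm) _; rewrite mulrA ler_wpM2r ?sqr_ge0//.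
  by rewrite ler_pdivrMr; lra.
by rewrite (exprS m 2) ler_wpM2r ?sqr_ge0.
Qed.

Lemma card_gt0_of_f_neq0 (n : nat) (S : {set {set {set 'I_n}}}) (j : nat) :
  f_ S j <> 0%N -> (0 < #|S|)%N.
Proof.
move=> fj; rewrite card_gt0; apply/negP => /eqP S0; apply: fj.
apply/eqP; rewrite cards_eq0; apply/eqP/finset.setP => p.
by rewrite !inE S0 !inE.
Qed.

Lemma sum_f_tail_le (R : realType) (n h : nat) (S : {set {set {set 'I_n}}}) (gamma : R) :
  (h <= 'C(n, 2))%N ->
  \sum_(j < h.+1 | gamma < j%:R) (f_ S j)%:R <= tail S gamma.
Proof.
move=> hN; rewrite -(big_mkord (fun j => gamma < j%:R) (fun j => (f_ S j)%:R)).
by rewrite /tail [leRHS](@big_cat_nat _ _ _ h.+1)//= lerDl sumr_ge0.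
Qed.

(** [second_moment_bound] applied to f_ S, in terms of the hypotheses of the
    theorem.  The lower bound on K * rho makes condition (a) speak of j = 1,
    and so ensures that S is nonempty and that delta is nonnegative. *)
Lemma num_sub_second_moment_le (R : realType) (n m h : nat)
    (S : {set {set {set 'I_n}}}) (gamma K delta w tau kappa : R)
    (N := 'C(n, 2)%:R : R) (rho := h%:R ^+ 2 / m%:R : R) :
  (0 < m <= 'C(n, 2))%N -> S \subset graphs n h ->
  (6 * h <= m)%N -> 4 <= K -> K * h%:R <= m%:R -> 1 <= K * rho ->
  delta * (K * rho) + 3 * (1 + K) * (h%:R ^+ 3 / m%:R ^+ 2) <= w -> w < 1 ->
  expR (1 + (expR 1 - K) * rho) <= tau -> tau < 1 ->
  (forall j : nat, (1 <= j)%N -> j%:R <= K * rho ->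
     f_ S j.-1 <> 0%N /\
     exists2 e : R, `|e| <= delta & r_ R S j = h%:R ^+ 2 / (N * j%:R) * (1 + e)) ->
  (forall j : nat, 4 * rho <= j%:R -> j%:R <= gamma ->
     f_ S j.-1 <> 0%N /\ r_ R S j <= m%:R / (2 * N)) ->
  tail S gamma <= kappa * (mu_ R m h S * #|S|%:R) ->
  let X := fun G => (num_sub S G)%:R : R in
  0 < E_gnm m X /\
  E_gnm m (fun G => X G ^+ 2) / E_gnm m X ^+ 2 <=
    (1 + 4 * tau) / ((1 - w) ^+ 2 * (1 - tau)) + kappa.
Proof.
move=> /andP[m0 mN] Sh hm K4 Khm Krho wE w1 tauE tau1 fa fb fc X.
have r_mul (j : nat) : f_ S j <> 0%N -> (f_ S j.+1)%:R = (f_ S j)%:R * r_ R S j.+1.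
  by move=> /eqP fj; rewrite /r_ mulrC divfK// pnatr_eq0.
have [f0 [e0 de _]] := fa 1%N isT Krho.
have S0 : (0 < #|S|)%N := card_gt0_of_f_neq0 _ _ _ f0.
have d0 : 0 <= delta := le_trans (normr_ge0 _) de.
have h_le_2h : (h <= 2 * h)%N by rewrite leq_pmull.
have hm2 : (2 * h <= m)%N by rewrite (leq_trans _ hm)// leq_mul2r orbT.
have EX : E_gnm m X = #|S|%:R * incl_prob R 'C(n, 2) m h.
  by apply: E_gnm_num_sub Sh _; exact: leq_trans hm2.
have EX0 : 0 < E_gnm m X by rewrite EX mulr_gt0 ?incl_prob_gt0 ?ltr0n.
split => //; rewrite ler_pdivrMr ?exprn_gt0// mulrC EX exprMn.
rewrite (E_gnm_num_sub_sqr R n m h S Sh hm2) -(sum_f_ R n h S Sh).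
apply: (second_moment_bound R _ m h (fun j => (f_ S j)%:R) gamma K delta) => //
  [j jK|j rj jg|].
- have [fj [e eE rE]] := fa j.+1 isT jK; exists e => //.
  by rewrite r_mul// rE invfM !mulrA.
- by have [fj rj'] := fb j.+1 rj jg; rewrite r_mul// ler_wpM2l.
apply: le_trans (sum_f_tail_le _ _ _ _ _ _) (le_trans fc _).
  by rewrite (leq_trans _ mN)// (leq_trans _ hm2).
rewrite (sum_f_ R n h S Sh) /mu_ le_eqVlt; apply/orP; left; apply/eqP.
by rewrite /incl_prob; ring.
Qed.

(* Opened only here: in this scope [set x | P x] no longer denotes a finite set. *)
Local Open Scope classical_set_scope.

Theorem theorem1 (R : realType) (m h : nat -> nat)
    (S : forall n : nat, {set {set {set 'I_n}}}) (gamma : nat -> R)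
    (N := fun n : nat => 'C(n, 2)%:R : R)
    (rho := fun n : nat => (h n)%:R ^+ 2 / (m n)%:R : R)
    (hm : \forall n \near \oo, (0 < m n <= 'C(n, 2))%N)
    (hS : forall n : nat, S n \subset graphs n (h n))
    (hm3 : (fun n : nat => (h n)%:R ^+ 3 : R^o) =o_\oo
           (fun n : nat => (m n)%:R ^+ 2 : R^o))
    (hm2 : (fun n : nat => (h n)%:R ^+ 2 : R^o) =Omega_\oo
           (fun n : nat => (m n)%:R : R^o))
    (ha : forall K : R, 0 < K ->
       exists2 delta : nat -> R^o,
         delta =o_\oo (fun n : nat => (m n)%:R / (h n)%:R ^+ 2 : R^o) &
         \forall n \near \oo, forall j : nat, (1 <= j)%N -> j%:R <= K * rho n ->
           f_ (S n) j.-1 <> 0%N /\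
           exists2 e : R, `|e| <= delta n &
             r_ R (S n) j = (h n)%:R ^+ 2 / (N n * j%:R) * (1 + e))
    (hb : \forall n \near \oo, forall j : nat,
       4 * rho n <= j%:R -> j%:R <= gamma n ->
       f_ (S n) j.-1 <> 0%N /\ r_ R (S n) j <= (m n)%:R / (2 * N n))
    (hc : (fun n : nat => tail (S n) (gamma n) : R^o) =o_\oo
          (fun n : nat => mu_ R (m n) (h n) (S n) * #|S n|%:R : R^o)) :
  cvg_in_prob_gnm m
    (fun (n : nat) (G : {set {set 'I_n}}) =>
       (num_sub (S n) G)%:R /
       E_gnm (m n) (fun G' : {set {set 'I_n}} => (num_sub (S n) G')%:R : R))
    1.
Proof.
move=> eps eps0; apply/cvgrPdist_le => e e0.
pose d := Num.min 1 (e * eps ^+ 2).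
have d0 : 0 < d by rewrite lt_min ltr01 mulr_gt0 ?exprn_gt0.
have d1 : d <= 1 by rewrite ge_min lexx.
have de : d / eps ^+ 2 <= e by rewrite ler_pdivrMr ?exprn_gt0// ge_min lexx orbT.
pose t := d / 20.
have t0 : 0 < t by rewrite divr_gt0.
have [c c0 rho_ge] : exists2 c : R, 0 < c & \forall n \near \oo, c * (m n)%:R <= (h n)%:R ^+ 2.
  move: hm2; rewrite eqOmegaE qualifE => /asboolP[c c0 H]; exists c => //.
  near do rewrite -[X in c * X <= _]normr_nat -[leRHS]ger0_norm ?sqr_ge0//.
  exact: H.
clear hm2.
(* The last summand of K makes (K - e) rho - 1 at least 1/t, so that its
   exponential e^(- 1/t) <= t is within the error allowed to tau. *)
pose K := 4 + expR 1 + (1 + t^-1) / c.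
have tc0 : 0 < (1 + t^-1) / c by rewrite divr_gt0 ?addr_gt0 ?invr_gt0.
have E0 := expR_gt0 (1 : R).
have K0 : 0 < K by rewrite /K; lra.
have [delta hdelta fa] := ha K K0.
(* Two halves of the error t allowed to w: K rho delta <= t/2, where
   rho * (m / h^2) = 1, and 3 (1 + K) h^3/m^2 <= t/2. *)
have eta0 : 0 < t / (2 * K) by rewrite divr_gt0 ?mulr_gt0.
have eta1 : 0 < t / (6 * (1 + K)) by rewrite divr_gt0 ?mulr_gt0 ?addr_gt0.
have eta2 : 0 < ((K + 6) ^+ 3 + 1)^-1.
  by rewrite invr_gt0 addr_gt0 ?exprn_gt0 ?addr_gt0.
move/eqoP: hdelta => /(_ _ eta0) dle.
move/eqoP: hc => /(_ _ t0) taille.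
move/eqoP: hm3 => hm3; have hle1 := hm3 _ eta1; have hle2 := hm3 _ eta2.
near=> n.
have mN : (0 < m n <= 'C(n, 2))%N by near: n.
have m0 : 0 < (m n)%:R :> R by rewrite ltr0n; case/andP: mN.
have Kh6 : (K + 6) * (h n)%:R <= (m n)%:R.
  apply: mul_le_of_cube_le => //.
  - by lra.
  - by rewrite ler1n -(ltr0n R).
  - rewrite -[leLHS]ger0_norm ?exprn_ge0// -[X in _ * X]ger0_norm ?sqr_ge0//.
    by near: n.
have h0 : 0 <= (h n)%:R :> R by [].
have hm6 : (6 * h n <= m n)%N.
  rewrite -(ler_nat R) natrM; have := mulr_ge0 (ltW K0) h0; lra.
have Khm : K * (h n)%:R <= (m n)%:R by lra.
have ti0 : 0 < t^-1 by rewrite invr_gt0.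
have rhoc : c <= rho n by rewrite ler_pdivlMr//; near: n.
have Kc : 1 + t^-1 <= (K - expR 1) * rho n.
  apply: le_trans (_ : (1 + t^-1) / c * rho n <= _).
    by rewrite -mulrA ler_peMr ?addr_ge0 ?(ltW ti0)// mulrC ler_pdivlMr ?mul1r.
  by rewrite ler_wpM2r ?(le_trans (ltW c0))// /K; lra.
have rho0 : 0 < rho n by exact: lt_le_trans c0 rhoc.
have tauE : expR (1 + (expR 1 - K) * rho n) <= t.
  apply: le_trans (_ : expR (- t^-1) <= _); first by rewrite ler_expR; lra.
  rewrite expRN -[leRHS]invrK lef_pV2 ?posrE ?expR_gt0//.
  by rewrite (le_trans _ (expR_ge1Dx _))// lerDr.
have h1 : 0 < (h n)%:R ^+ 2 :> R.
  by move: rho0; rewrite /rho pmulr_lgt0// invr_gt0.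
have hn0 : (h n)%:R != 0 :> R by rewrite -sqrf_eq0 gt_eqF.
have wE : delta n * (K * rho n) + 3 * (1 + K) * ((h n)%:R ^+ 3 / (m n)%:R ^+ 2) <= t.
  have dK : delta n * (K * rho n) <= t / 2.
    rewrite -ler_pdivlMr ?(mulr_gt0 K0 rho0)//; apply: (le_trans (ler_norm (delta n : R))).
    rewrite [leRHS](_ : _ = t / (2 * K) * `|(m n)%:R / (h n)%:R ^+ 2|).
      by near: n.
    rewrite ger0_norm ?divr_ge0 ?sqr_ge0// /rho; field.
    by rewrite (gt_eqF K0) (gt_eqF m0) hn0.
  have hK : (h n)%:R ^+ 3 / (m n)%:R ^+ 2 <= t / (6 * (1 + K)).
    rewrite ler_pdivrMr ?exprn_gt0//.
    rewrite -[leLHS]ger0_norm ?exprn_ge0// -[X in _ * X]ger0_norm ?sqr_ge0//.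
    by near: n.
  have : 3 * (1 + K) * ((h n)%:R ^+ 3 / (m n)%:R ^+ 2) <= t / 2.
    apply: le_trans (ler_wpM2l _ hK) _; first by rewrite mulr_ge0//; lra.
    by rewrite le_eqVlt; apply/orP; left; apply/eqP; field; lra.
  lra.
have t1 : t < 1 by rewrite /t; lra.
have K4 : 4 <= K by rewrite /K; lra.
have Krho : 1 <= K * rho n.
  have : 0 < expR 1 * rho n by rewrite mulr_gt0.
  lra.
have [|||EX0 EX2] := num_sub_second_moment_le R n (m n) (h n) (S n) (gamma n) K
  (delta n) t t t mN (hS n) hm6 K4 Khm Krho wE t1 tauE t1.
- by near: n.
- by near: n.
- rewrite -[X in _ * X]ger0_norm ?mulr_ge0 ?invr_ge0//.
  by apply: (le_trans (ler_norm (tail (S n) (gamma n) : R))); near: n.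
rewrite sub0r normrN ger0_norm ?divr_ge0//.
have /andP[_ mN2] := mN.
apply: le_trans (Pr_gnm_chebyshev R n (m n) _ eps mN2 eps0 _) _.
  by rewrite gt_eqF.
apply: le_trans de; rewrite ler_wpM2r ?invr_ge0 ?sqr_ge0//.
apply: le_trans (error_budget R d _); first by rewrite lerD2r.
by rewrite d0.
Unshelve. all: by end_near.
Qed.
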